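(* Let $G$ be a finite abelian group (written additively) and let $(\mathcal{K},\mathcal{X})$, with $\mathcal{K}=\{K_1,\dots,K_m\}$ and $\mathcal{X}=\{X_1,\dots,X_m\}$, be a supercharacter theory on $G$ with $\mathcal{K}$ symmetric. Let $\Gamma(G,S)$ be a super-Cayley graph with respect to $(\mathcal{K},\mathcal{X})$. Then: (1) The eigenvalues of $\Gamma(G,S)$, counted with multiplicity, are $\lambda_1,\dots,\lambda_m$, where $\lambda_i=\widehat{1_S}(K_i)$ is taken with multiplicity $|X_i|$. Here $1_S:G\to\mathbb{C}$ is the characteristic function of $S$ and $\widehat{1_S}$ is its super-Fourier transform. (2) Once the indexing $K_1,\dots,K_m$, $X_1,\dots,X_m$ is fixed, $S$ is uniquely determined by $(\lambda_1,\dots,\lambda_m)$: if $\Gamma(G,S)$ and $\Gamma(G,S')$ are super-Cayley graphs with respect to $(\mathcal{K},\mathcal{X})$ and $\widehat{1_S}(K_i)=\widehat{1_{S'}}(K_i)$ for all $1\le i\le m$, then $S=S'$.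
   Context: Supercharacter theory: let $\widehat{G}=\mathrm{Hom}(G,\mathbb{C}^\times)$. A supercharacter theory for $G$ is a pair $(\mathcal{K},\mathcal{X})$, where $\mathcal{K}=\{K_1,\dots,K_m\}$ is a partition of $G$ and $\mathcal{X}=\{X_1,\dots,X_m\}$ is a partition of $\widehat{G}$ (so $|\mathcal{K}|=|\mathcal{X}|=m$), such that: $\{0\}\in\mathcal{K}$; for each $i$ the function $\sigma_i=\sum_{\chi\in X_i}\chi$ is constant on each $K_j$ (its value there is denoted $\sigma_i(K_j)$); and for all $i,j$ the sum $\Omega_j(\chi)=\sum_{k\in K_j}\chi(k)$ does not depend on the choice of $\chi\in X_i$. $\mathcal{K}$ is symmetric if $K_i=-K_i$ for all $i$. For $S\subseteq G$ with $S=-S$ and $0\notin S$, the Cayley graph $\Gamma(G,S)$ has vertex set $G$, with $u,v$ adjacent iff $u-v\in S$. Its eigenvalues are those of its adjacency matrix. It is a super-Cayley graph with respect to $(\mathcal{K},\mathcal{X})$ if $S$ is a union of some classes in $\mathcal{K}$. A superclass function is a function $f:G\to\mathbb{C}$ constant on each $K_i$; its value on $K_i$ is denoted $f(K_i)$. The functions $\sigma_1,\dots,\sigma_m$ form a basis of the space of superclass functions. The (non-normalized) super-Fourier transform of a superclass function $f$ is the superclass function $\widehat{f}$ whose values $\widehat{f}(K_\ell)$ are determined by $f=\frac{1}{|G|}\sum_{\ell=1}^m\widehat{f}(K_\ell)\,\sigma_\ell$. *)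

(* Defs.v *)
From HB Require Import structures.
From mathcomp Require Import all_boot all_order all_algebra.
From mathcomp Require classical_sets.
From mathcomp Require Import reals complex.

Set Implicit Arguments.
Unset Strict Implicit.
Unset Printing Implicit Defensive.

Import GRing.Theory.
Local Open Scope ring_scope.

Section Dual.
Variables (R : realType) (G : finZmodType).

Definition is_character (chi : {ffun G -> R[i]}) : bool :=
  [forall x, chi x != 0] && [forall x, forall y, chi (x + y) == chi x * chi y].

(* The dual group Hom(G, C\{0}), as a type of complex-valued functions. *)
Record dual : predArgType :=
  Dual { dual_val :> {ffun G -> R[i]}; _ : is_character dual_val }.

HB.instance Definition _ := [isSub for dual_val].
HB.instance Definition _ := [Choice of dual by <:].

Lemma dual_neq0 (chi : dual) x : chi x != 0.
Proof. by have /andP[/forallP/(_ x)] := valP chi. Qed.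

Lemma dualD (chi : dual) x y : chi (x + y) = chi x * chi y.
Proof. by have /andP[_ /forallP/(_ x)/forallP/(_ y)/eqP] := valP chi. Qed.

Lemma dual_unity (chi : dual) x : chi x ^+ #|G| = 1.
Proof.
have P_neq0 : \prod_y chi y != 0.
  by apply/prodf_neq0 => y _; apply: dual_neq0.
apply: (mulIf P_neq0).
rewrite mul1r -prodr_const -big_split /= [RHS](reindex_inj (addrI x)).
by apply: eq_bigr => y _; rewrite dualD.
Qed.

Definition unity_roots : seq R[i] :=
  sval (closed_field_poly_normal ('X^#|G| - 1 : {poly R[i]})).

Lemma mem_unity_roots (chi : dual) x : chi x \in unity_roots.
Proof.
rewrite /unity_roots; case: closed_field_poly_normal => r /= Er.
have G_gt0 : (0 < #|G|)%N by apply/card_gt0P; exists 0.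
have: root ('X^#|G| - 1) (chi x).
  by rewrite rootE !hornerE ?hornerXn dual_unity subrr.
rewrite Er (monicP (monicXnsubC _ G_gt0)) scale1r.
by rewrite root_prod_XsubC.
Qed.

Definition dual_to_roots (chi : dual) : {ffun G -> seq_sub unity_roots} :=
  [ffun x => SeqSub (mem_unity_roots chi x)].

Definition dual_of_roots (f : {ffun G -> seq_sub unity_roots}) : option dual :=
  insub [ffun x => val (f x)].

Lemma dual_to_rootsK : pcancel dual_to_roots dual_of_roots.
Proof.
move=> chi; rewrite /dual_of_roots -[RHS]valK; congr insub.
by apply/ffunP => x; rewrite !ffunE.
Qed.

HB.instance Definition _ : isCountable dual := PCanIsCountable dual_to_rootsK.
HB.instance Definition _ : isFinite dual := PCanIsFinite dual_to_rootsK.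

End Dual.

Section Supercharacter.
Variables (R : realType) (G : finZmodType) (m : nat).
Variables (K : 'I_m -> {set G}) (X : 'I_m -> {set dual R G}).

(* K_1, ..., K_m and X_1, ..., X_m enumerate the blocks of two partitions,
   without repetition; the index type 'I_m starts at 0. *)
Definition enumerates_partition (T : finType) (P : 'I_m -> {set T}) : Prop :=
  injective P /\ partition [set P i | i : 'I_m] [set: T].

Definition sigma (i : 'I_m) : {ffun G -> R[i]} :=
  [ffun x => \sum_(chi in X i) chi x].

Definition superclass_function (f : {ffun G -> R[i]}) : Prop :=
  forall i x y, x \in K i -> y \in K i -> f x = f y.

Record supercharacter_theory : Prop := {
  superclass_partition : enumerates_partition K;
  superchar_partition : enumerates_partition X;
  superclass0 : exists i, K i = [set 0];
  sigma_superclass : forall i, superclass_function (sigma i);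
  Omega_superchar : forall i j chi psi, chi \in X i -> psi \in X i ->
    \sum_(k in K j) chi k = \sum_(k in K j) psi k }.

Definition symmetric_superclasses : Prop :=
  forall i, [set - x | x in K i] = K i.

(* The value f(A) of a function that is constant on the nonempty set A. *)
Definition class_val (f : {ffun G -> R[i]}) (A : {set G}) : R[i] :=
  if [pick x in A] is Some x then f x else 0.

Definition is_super_fourier (f g : {ffun G -> R[i]}) : Prop :=
  superclass_function g /\
  forall x, f x = #|G|%:R^-1 * \sum_(l < m) class_val g (K l) * sigma l x.

(* For a superclass function f, the unique g such that is_super_fourier f g. *)
Definition super_fourier (f : {ffun G -> R[i]}) : {ffun G -> R[i]} :=
  classical_sets.xget 0 (is_super_fourier f).

Definition indicator (S : {set G}) : {ffun G -> R[i]} :=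
  [ffun x => (x \in S)%:R].

Definition super_lambda (S : {set G}) (i : 'I_m) : R[i] :=
  class_val (super_fourier (indicator S)) (K i).

End Supercharacter.

Section CayleyGraph.
Variables (R : realType) (G : finZmodType).

Definition connection_set (S : {set G}) : Prop :=
  [set - x | x in S] = S /\ 0 \notin S.

Definition cayley (S : {set G}) : rel G := fun u v => u - v \in S.

Definition super_cayley (m : nat) (K : 'I_m -> {set G}) (S : {set G}) : Prop :=
  connection_set S /\ exists J : {set 'I_m}, S = \bigcup_(j in J) K j.

Definition adjacency_matrix (T : finType) (e : rel T) : 'M[R[i]]_#|T| :=
  \matrix_(u, v) (e (enum_val u) (enum_val v))%:R.

(* s lists the eigenvalues of A, each as often as its multiplicity as a root
   of the characteristic polynomial. *)
Definition eigenvalues_with_mult n (A : 'M[R[i]]_n) (s : seq R[i]) : Prop :=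
  char_poly A = \prod_(z <- s) ('X - z%:P).

End CayleyGraph.

(* Main.v *)
(* The characters of G diagonalize the adjacency matrix, the eigenvalue at chi
   being the sum of chi over S. By the condition on the Omega_j this depends
   only on the block X_i of chi, and since S = - S it is the Fourier
   coefficient of 1_S at chi, that is, the value on K_i of the super-Fourier
   transform of 1_S. Fourier inversion then recovers S from these values. *)
Require Import Defs.
From mathcomp Require Import all_boot all_order all_algebra.
From mathcomp Require Import separable cyclotomic reals complex.
From mathcomp Require classical_sets.

Set Implicit Arguments.
Unset Strict Implicit.
Unset Printing Implicit Defensive.

Import GRing.Theory.
Local Open Scope ring_scope.

(** * Diagonalizable matrices and characteristic polynomials *)

(** The minimal polynomial of [A] divides ['X^k - 1], which splits over a closed field and has
    simple roots when [k] is invertible. *)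
Lemma diagonalizable_expr_eq1 (F : closedFieldType) n (A : 'M[F]_n.+1) k :
  k%:R != 0 :> F -> A ^+ k = 1 -> diagonalizable A.
Proof.
move=> k_neq0 Ak1; have k_gt0 : (0 < k)%N by case: k k_neq0 {Ak1}; rewrite ?eqxx.
have [rs] := closed_field_poly_normal ('X^k - 1 : {poly F}).
rewrite (monicP (monicXnsubC _ k_gt0)) scale1r => Ers.
apply/diagonalizableP; exists rs.
  by rewrite -separable_prod_XsubC -Ers separable_Xn_sub_1.
rewrite -Ers; apply: mxminpoly_min.
by rewrite rmorphB rmorphXn rmorph1 /= horner_mx_X Ak1 subrr.
Qed.

(** Conjugation by [P], with determinants cancelled. The sizes [n] and [p] are kept apart because
    the character table has rows indexed by the dual group and columns by [G], whose cardinals are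
    equal only by a theorem. *)
Lemma char_poly_diag_intertwine (F : fieldType) n p (P : 'M[F]_(n, p))
    (Q : 'M[F]_(p, n)) (A : 'M_p) (d : 'rV_n) :
    n = p -> P *m Q = 1%:M -> P *m A = diag_mx d *m P ->
  char_poly A = \prod_i ('X - (d 0 i)%:P).
Proof.
move=> e; case: p / e P Q A => P Q A /mulmx1_unit[Pu _] PA.
have detP_neq0 : (\det P)%:P != 0 :> {poly F}.
  by rewrite polyC_eq0 -unitfE; move: Pu; rewrite unitmxE.
have -> : \prod_i ('X - (d 0 i)%:P) = char_poly (diag_mx d).
  rewrite char_poly_trig ?diag_mx_is_trig //.
  by apply: eq_bigr => i _; rewrite mxE eqxx.
apply: (mulfI detP_neq0); rewrite [RHS]mulrC /char_poly -det_map_mx -!det_mulmx.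
congr (\det _); rewrite mulmxBr mulmxBl -!map_mxM PA.
by rewrite scalar_mxC.
Qed.

(** * Translations of a finite abelian group *)

(** Translation by [x] permutes [G], so it preserves the sum of all elements while adding
    [x *+ #|G|] to it. *)
Lemma mulrn_card (G : finZmodType) (x : G) : x *+ #|G| = 0.
Proof.
apply: (addIr (\sum_(y : G) y)); rewrite add0r -sumr_const -big_split /=.
by rewrite [RHS](reindex_inj (addrI x)).
Qed.

Section Translations.
Variables (F : fieldType) (G : finZmodType) (n : nat).
Variables (f : 'I_n.+1 -> G).
Hypothesis f_bij : bijective f.

(** The regular representation of [G]. Indexing through [f] gives the matrices a successor size,
    hence a ring structure in which powers make sense. *)
Definition translation_mx (x : G) : 'M[F]_n.+1 :=
  \matrix_(i, j) (f j == f i + x)%:R.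

Lemma translation_mx0 : translation_mx 0 = 1.
Proof.
by apply/matrixP=> i j; rewrite !mxE addr0 (inj_eq (bij_inj f_bij)) eq_sym.
Qed.

Lemma translation_mxD x y :
  translation_mx (x + y) = translation_mx x * translation_mx y.
Proof.
have [g fK gK] := f_bij; apply/matrixP=> i j; rewrite !mxE.
rewrite (bigD1 (g (f i + x))) //= big1 ?addr0 => [|k k_neq].
  by rewrite !mxE gK eqxx mul1r addrA.
have /negPf neq : f k != f i + x by apply: contraNneq k_neq => <-; rewrite fK.
by rewrite mxE neq mul0r.
Qed.

Lemma translation_mxMn x k : translation_mx (x *+ k) = translation_mx x ^+ k.
Proof.
elim: k => [|k IHk]; first exact: translation_mx0.
by rewrite mulrS translation_mxD IHk exprS.
Qed.

Lemma translation_mx_eq1 x : translation_mx x = 1 -> x = 0.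
Proof.
have [g fK gK] := f_bij; move=> /matrixP/(_ (g 0) (g 0)).
rewrite !mxE gK add0r eqxx.
by case: eqP => // _ /eqP; rewrite eq_sym oner_eq0.
Qed.

End Translations.

(** * Characters separate points *)

Section Characters.
Variables (R : realType) (G : finZmodType).
Implicit Types (chi psi : dual R G) (x y : G).

Lemma dual0 chi : chi 0 = 1.
Proof.
by apply: (mulfI (dual_neq0 chi 0)); rewrite -dualD addr0 mulr1.
Qed.

Lemma dualN_mul chi x : chi (- x) * chi x = 1.
Proof. by rewrite -dualD addNr dual0. Qed.

Lemma natr_card_neq0 : #|G|%:R != 0 :> R[i].
Proof. by rewrite Num.Theory.pnatr_eq0 -lt0n; apply/card_gt0P; exists 0. Qed.

(* The translations of G commute and have finite order, so they are
   simultaneously diagonalizable; each diagonal entry is a character, and a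
   translation all of whose diagonal entries are 1 is trivial. *)
Lemma dual_separates x : x != 0 -> exists chi, chi x != 1.
Proof.
move=> x_neq0; have card_gt0 : (0 < #|G|)%N by apply/card_gt0P; exists 0.
pose f := (fun i => enum_val (cast_ord (prednK card_gt0) i)) : _ -> G.
have f_bij : bijective f.
  pose g (y : G) := cast_ord (esym (prednK card_gt0)) (enum_rank y).
  exists g => i; rewrite /f /g; first by rewrite enum_valK cast_ordK.
  by rewrite cast_ordKV enum_rankK.
pose T y := translation_mx R[i] f y.
have /codiagonalizableP[P Pu /allP Pdiag] :
    {in [seq T y | y : G] &, forall A B, comm_mx A B} /\
    {in [seq T y | y : G], forall A, diagonalizable A}.
  split=> [_ _ /mapP[y _ ->] /mapP[z _ ->] | _ /mapP[y _ ->]].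
    by rewrite /comm_mx !mulmxE -!translation_mxD // addrC.
  apply: (@diagonalizable_expr_eq1 _ _ _ #|G|); first exact: natr_card_neq0.
  rewrite -translation_mxMn // -(translation_mx0 _ f_bij); congr translation_mx.
  exact: mulrn_card.
(* [D y] is the translation by [y] written in a common eigenbasis; its [k]-th diagonal entry, as a
   function of [y], will be a character. *)
pose D y := P *m T y *m invmx P.
have D_diag y k l : k != l -> D y k l = 0.
  move=> kl; have := Pdiag _ (map_f T (mem_enum G y)).
  by move/(diagonalizable_forP _ Pu)/(_ k l kl).
have D0 : D 0 = 1%:M by rewrite /D /T translation_mx0 // mulmx1 mulmxV.
have DD y z : D (y + z) = D y *m D z.
  by rewrite /D /T translation_mxD // -mulmxE !mulmxA mulmxKV.
have DDk y z k : D (y + z) k k = D y k k * D z k k.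
  rewrite DD mxE (bigD1 k) //= big1 ?addr0 // => l lk.
  by rewrite D_diag ?mul0r // eq_sym.
have D_char k : is_character [ffun y => D y k k].
  apply/andP; split; apply/forallP => y; last first.
    by apply/forallP => z; rewrite !ffunE DDk.
  (* A zero entry at [y] would make the entry of [D 0 = 1] vanish as well. *)
  rewrite ffunE; apply/eqP => Dyk0; have := DDk y (- y) k.
  by rewrite Dyk0 mul0r subrr D0 mxE eqxx => /eqP; rewrite oner_eq0.
have [/existsP[k Dk]|/existsPn D1] := boolP [exists k, D x k k != 1].
  by exists (Dual (D_char k)); rewrite /= ffunE.
case/eqP: x_neq0; apply: (@translation_mx_eq1 R[i] _ _ _ f_bij).
have Dx1 : D x = 1%:M.
  apply/matrixP => k l; rewrite [RHS]mxE; have [<-|kl] := eqVneq k l.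
    by have /negPn/eqP-> := D1 k.
  by rewrite D_diag.
by rewrite -[LHS](mulKmx Pu) -[P *m _](mulmxKV Pu) -/(D x) Dx1 mul1mx mulVmx.
Qed.

(** * Orthogonality relations and the order of the dual group *)

Lemma dual_mul_subproof chi psi : is_character [ffun x => chi x * psi x].
Proof.
apply/andP; split; apply/forallP => x; first by rewrite ffunE mulf_neq0 ?dual_neq0.
by apply/forallP => y; rewrite !ffunE !dualD mulrACA.
Qed.

Definition dual_mul chi psi : dual R G := Dual (dual_mul_subproof chi psi).

Lemma dual_mulI chi : injective (dual_mul chi).
Proof.
move=> psi psi' /(congr1 val)/ffunP E; apply/val_inj/ffunP => x.
by apply: (mulfI (dual_neq0 chi x)); have := E x; rewrite !ffunE.
Qed.

(** Here [psi (- x)] is the inverse of [psi x]. If the characters differ at [y], the substitution of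
    [y + x] for [x] shows that the sum is killed by [chi y - psi y]. *)
Lemma dual_orthogonality chi psi :
  \sum_x chi x * psi (- x) = if chi == psi then #|G|%:R else 0.
Proof.
have [<-|neq] := eqVneq.
  under eq_bigr do rewrite mulrC dualN_mul.
  by rewrite sumr_const.
have [y neq_y] : exists y, chi y != psi y.
  apply/existsP; apply: contra_neqT neq => /existsPn E.
  by apply/val_inj/ffunP => y; apply/eqP; have := E y; rewrite negbK.
set T := \sum_x _; apply/eqP; have : (chi y - psi y) * T == 0.
  rewrite mulrBl subr_eq0; apply/eqP; rewrite {1}/T.
  rewrite [T](reindex_inj (addrI y)) /= !mulr_sumr; apply: eq_bigr => x _.
  rewrite dualD opprD dualD mulrACA [RHS]mulrA [psi y * _]mulrCA.
  by rewrite [psi y * _]mulrC dualN_mul mulr1.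
by rewrite mulf_eq0 subr_eq0 (negPf neq_y).
Qed.

(** Multiplication by a character [psi] with [psi x != 1] permutes the dual group and scales the sum
    by [psi x]. *)
Lemma sum_dual_eq0 x : x != 0 -> \sum_(chi : dual R G) chi x = 0.
Proof.
move=> /dual_separates[psi psi_x]; set T := \sum_chi _.
apply/eqP; have : (psi x - 1) * T == 0.
  rewrite mulrBl mul1r subr_eq0; apply/eqP.
  rewrite [RHS](reindex_inj (@dual_mulI psi)) mulr_sumr /=.
  by apply: eq_bigr => chi _; rewrite ffunE.
by rewrite mulf_eq0 subr_eq0 (negPf psi_x).
Qed.

Definition dual1 : dual R G.
Proof.
apply: (@Dual _ _ [ffun=> 1]); apply/andP; split; apply/forallP => x.
  by rewrite ffunE oner_neq0.
by apply/forallP => y; rewrite !ffunE mulr1.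
Defined.

(* Double counting of the sum of chi x over all pairs (chi, x). *)
Lemma card_dual : #|dual R G| = #|G|.
Proof.
apply/eqP; rewrite -(Num.Theory.eqr_nat R[i]); apply/eqP.
transitivity (\sum_(x : G) \sum_(chi : dual R G) chi x).
  rewrite (bigD1 0) //= [X in _ + X]big1 ?addr0 => [|x]; last exact: sum_dual_eq0.
  by under eq_bigr do rewrite dual0; rewrite sumr_const.
rewrite exchange_big (bigD1 dual1) //= [X in _ + X]big1 ?addr0 => [|chi chi1].
  by under eq_bigr do rewrite ffunE; rewrite sumr_const.
transitivity (\sum_x chi x * dual1 (- x)).
  by apply: eq_bigr => x _; rewrite ffunE mulr1.
by rewrite dual_orthogonality (negPf chi1).
Qed.

Lemma sum_dual x : \sum_(chi : dual R G) chi x = if x == 0 then #|G|%:R else 0.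
Proof.
have [->|] := eqVneq; last exact: sum_dual_eq0.
by under eq_bigr do rewrite dual0; rewrite sumr_const -card_dual.
Qed.

(** * Fourier inversion on the group and on its dual *)

(** After the sums are exchanged, [sum_dual] leaves only the term [y = x]. *)
Lemma fourier_inversion (f : G -> R[i]) x :
  f x = #|G|%:R^-1 * \sum_(chi : dual R G) (\sum_y f y * chi (- y)) * chi x.
Proof.
apply: (mulfI natr_card_neq0); rewrite mulVKf ?natr_card_neq0 //.
under eq_bigr do rewrite mulr_suml.
rewrite exchange_big /= (bigD1 x) //= [X in _ + X]big1 ?addr0 => [|y y_neq].
  under eq_bigr do rewrite -mulrA dualN_mul.
  by rewrite -mulr_sumr sumr_const card_dual mulrC.
under eq_bigr do rewrite -mulrA -dualD.
by rewrite -mulr_sumr sum_dual addrC subr_eq0 eq_sym (negPf y_neq) mulr0.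
Qed.

(** The converse of inversion, by [dual_orthogonality]: the coefficients of an expansion in
    characters are determined by the function. *)
Lemma fourier_coef (a : dual R G -> R[i]) chi :
  \sum_x (#|G|%:R^-1 * \sum_psi a psi * psi x) * chi (- x) = a chi.
Proof.
under eq_bigr do rewrite -mulrA mulr_suml.
rewrite -mulr_sumr exchange_big /=.
under eq_bigr => psi _.
  under eq_bigr do rewrite -mulrA.
  rewrite -mulr_sumr dual_orthogonality; over.
rewrite (bigD1 chi) //= eqxx [X in _ + X]big1 ?addr0 => [|psi /negPf->].
  by rewrite mulrC mulfK // natr_card_neq0.
by rewrite mulr0.
Qed.

(** * The spectrum of a Cayley graph *)

(** The rows of the character table [F] are left eigenvectors of the adjacency matrix, and
    orthogonality makes [F'] a right inverse of [F]. *)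
Lemma char_poly_cayley (S : {set G}) :
  char_poly (adjacency_matrix R (cayley S)) =
  \prod_(chi : dual R G) ('X - (\sum_(s in S) chi s)%:P).
Proof.
pose F : 'M[R[i]]_(#|dual R G|, #|G|) :=
  \matrix_(k, u) (enum_val k : dual R G) (enum_val u).
pose F' : 'M[R[i]]_(#|G|, #|dual R G|) :=
  \matrix_(u, k) (#|G|%:R^-1 * (enum_val k : dual R G) (- enum_val u)).
pose d : 'rV[R[i]]_#|dual R G| :=
  \row_k \sum_(s in S) (enum_val k : dual R G) s.
rewrite (@char_poly_diag_intertwine _ _ _ F F' _ d card_dual).
- rewrite [RHS](reindex (@enum_val _ (dual R G))) /=; last first.
    by apply: onW_bij; apply: enum_val_bij.
  by apply: eq_bigr => k _; rewrite mxE.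
- apply/matrixP => k l; rewrite !mxE.
  under eq_bigr do rewrite !mxE mulrCA.
  rewrite -mulr_sumr -(reindex (@enum_val _ G) (P := predT)
    (F := fun x => (enum_val k : dual R G) x * (enum_val l : dual R G) (- x))) /=;
    last by apply: onW_bij; apply: enum_val_bij.
  rewrite dual_orthogonality (inj_eq enum_val_inj).
  by case: eqP; rewrite ?mulr0 // mulVf ?natr_card_neq0.
- apply/matrixP => k v; rewrite mul_diag_mx !mxE.
  under eq_bigr do rewrite !mxE.
  rewrite -(reindex (@enum_val _ G) (P := predT)
    (F := fun x => (enum_val k : dual R G) x * (cayley S x (enum_val v))%:R)) /=;
    last by apply: onW_bij; apply: enum_val_bij.
  (* With [x = s + v], adjacency of [x] and [v] becomes [s \in S], and the factor [chi v] comes out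
     of the sum. *)
  rewrite (reindex_inj (addIr (enum_val v))) mulr_suml [RHS]big_mkcond /=.
  apply: eq_bigr => s _; rewrite /cayley addrK dualD.
  by case: ifP; rewrite ?mulr1 ?mulr0.
Qed.

End Characters.

(** * Superclasses and the super-Fourier transform *)

Section Supercharacters.
Variables (R : realType) (G : finZmodType) (m : nat).
Variables (K : 'I_m -> {set G}) (X : 'I_m -> {set dual R G}).

(** With an index function, sums over the blocks become sums over its fibres, ready for
    [partition_big]. *)
Lemma enumerates_partition_index (T : finType) (P : 'I_m -> {set T}) :
    enumerates_partition P ->
  exists b : T -> 'I_m, forall x i, (x \in P i) = (b x == i).
Proof.
case=> P_inj /and3P[/eqP covP /trivIsetP trivP _].
have ex_index x : exists i, x \in P i.
  have : x \in cover [set P i | i : 'I_m] by rewrite covP.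
  by case/bigcupP => _ /imsetP[i _ ->]; exists i.
exists (fun x => xchoose (ex_index x)) => x i.
apply/idP/eqP => [x_i | <-]; last exact: (xchooseP (ex_index x)).
apply: P_inj; apply: contraTeq (xchooseP (ex_index x)) => /trivP.
by move=> /(_ (imset_f _ _) (imset_f _ _))/disjointFl->.
Qed.

Lemma enumerates_partition_neq0 (T : finType) (P : 'I_m -> {set T}) i :
  enumerates_partition P -> exists x, x \in P i.
Proof.
case=> _ /and3P[_ _ P_neq0]; apply/set0Pn.
by apply: contraNneq P_neq0 => <-; apply: imset_f.
Qed.

Lemma class_valE (f : {ffun G -> R[i]}) i x :
  superclass_function K f -> x \in K i -> class_val f (K i) = f x.
Proof.
move=> f_super x_i; rewrite /class_val; case: pickP => [y y_i | /(_ x)].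
  exact: f_super y_i x_i.
by rewrite x_i.
Qed.

(** This turns a super-Fourier expansion into an ordinary one whose coefficients are constant on
    each block of characters. *)
Lemma sum_sigma (b : dual R G -> 'I_m) (c : 'I_m -> R[i]) x :
    (forall chi i, (chi \in X i) = (b chi == i)) ->
  \sum_i c i * sigma X i x = \sum_chi c (b chi) * chi x.
Proof.
move=> bP; rewrite [RHS](partition_big b predT) //=; apply: eq_bigr => i _.
rewrite ffunE mulr_sumr; apply: eq_big => [chi | chi]; first exact: bP.
by rewrite bP => /eqP->.
Qed.

Hypothesis KX : supercharacter_theory K X.

(** [S] is a disjoint union of superclasses, so the sum splits into the sums Omega_j with [j] in
    [J], each constant on [X i]. *)
Lemma super_cayley_sum (S : {set G}) i chi psi :
    super_cayley K S -> chi \in X i -> psi \in X i ->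
  \sum_(s in S) chi s = \sum_(s in S) psi s.
Proof.
case=> _ [J ->] chi_i psi_i.
have [b bP] := enumerates_partition_index (superclass_partition KX).
have bJ x : (x \in \bigcup_(j in J) K j) = (b x \in J).
  apply/bigcupP/idP => [[j jJ] | bxJ]; first by rewrite bP => /eqP->.
  by exists (b x); rewrite ?bP.
have split_sum (phi : dual R G) :
    \sum_(s in \bigcup_(j in J) K j) phi s = \sum_(j in J) \sum_(k in K j) phi k.
  rewrite (partition_big b (mem J)) /= => [|x]; last by rewrite bJ.
  apply: eq_bigr => j jJ; apply: eq_bigl => x.
  by rewrite bJ bP andb_idl // => /eqP->.
rewrite !split_sum; apply: eq_bigr => j _.
exact: (Omega_superchar KX) chi_i psi_i.
Qed.

Lemma super_cayley_sumN (S : {set G}) (chi : dual R G) :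
  super_cayley K S -> \sum_(s in S) chi (- s) = \sum_(s in S) chi s.
Proof.
case=> -[SN _] _; rewrite -{2}SN big_imset //=.
by move=> x y _ _; apply: oppr_inj.
Qed.

Lemma indicator_coef (S : {set G}) (chi : dual R G) : super_cayley K S ->
  \sum_x indicator R S x * chi (- x) = \sum_(s in S) chi s.
Proof.
move=> S_super; rewrite -(super_cayley_sumN chi S_super) [RHS]big_mkcond /=.
by apply: eq_bigr => x _; rewrite ffunE; case: ifP; rewrite ?mul1r ?mul0r.
Qed.

(** [super_fourier] falls back to 0 unless a transform exists, so a witness is needed. On [K i] it
    takes the sum over [S] of one representative of [X i], whose choice is immaterial by
    [super_cayley_sum]. *)
Lemma super_fourier_indicator (S : {set G}) : super_cayley K S ->
  is_super_fourier K X (indicator R S) (super_fourier K X (indicator R S)).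
Proof.
move=> S_super; apply: classical_sets.xgetPex.
have [b bP] := enumerates_partition_index (superclass_partition KX).
have [c cP] := enumerates_partition_index (superchar_partition KX).
have X_neq0 i := enumerates_partition_neq0 i (superchar_partition KX).
pose rep i := xchoose (X_neq0 i).
pose g : {ffun G -> R[i]} := [ffun x => \sum_(s in S) rep (b x) s].
have g_super : superclass_function K g.
  by move=> i x y; rewrite !bP !ffunE => /eqP-> /eqP->.
exists g; split=> // x; rewrite (sum_sigma _ _ cP) [LHS]fourier_inversion.
congr (_ * _); apply: eq_bigr => chi _; congr (_ * _).
have [y y_i] := enumerates_partition_neq0 (c chi) (superclass_partition KX).
rewrite indicator_coef // (class_valE g_super y_i) ffunE.
apply: (super_cayley_sum S_super (i := c chi)); first by rewrite cP.
by move: y_i; rewrite bP => /eqP->; apply: (xchooseP (X_neq0 _)).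
Qed.

(** Whichever transform is selected, its expansion reproduces the indicator, and [fourier_coef]
    reads the coefficient at [chi] off that expansion. *)
Lemma super_lambdaE (S : {set G}) i chi : super_cayley K S -> chi \in X i ->
  super_lambda K X S i = \sum_(s in S) chi s.
Proof.
move=> S_super chi_i; have [_ hf] := super_fourier_indicator S_super.
have [c cP] := enumerates_partition_index (superchar_partition KX).
rewrite -indicator_coef //; move: chi_i; rewrite cP => /eqP<-.
under eq_bigr => x _ do rewrite hf (sum_sigma _ _ cP).
by rewrite (fourier_coef (fun psi => super_lambda K X S (c psi))).
Qed.

End Supercharacters.

Theorem theorem1p1 (R : realType) (G : finZmodType) (m : nat)
    (K : 'I_m -> {set G}) (X : 'I_m -> {set dual R G})
    (KX_theory : supercharacter_theory K X)
    (K_symmetric : symmetric_superclasses K) :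
  (forall S : {set G}, super_cayley K S ->
     eigenvalues_with_mult (adjacency_matrix R (cayley S))
       (flatten [seq nseq #|X i| (super_lambda K X S i) | i <- enum 'I_m])) /\
  (forall S S' : {set G}, super_cayley K S -> super_cayley K S' ->
     (forall i, super_lambda K X S i = super_lambda K X S' i) -> S = S').
Proof.
split=> [S S_super | S S' S_super S'_super eq_lambda].
  rewrite /eigenvalues_with_mult char_poly_cayley big_flatten big_map big_enum /=.
  have [c cP] := enumerates_partition_index (superchar_partition KX_theory).
  (* The characters are grouped by block; block [i] must contribute the power of exponent [#|X i|]
     of one linear factor. *)
  rewrite (partition_big c predT) //=; apply: eq_bigr => i _.
  rewrite big_nseq -Monoid.iteropE -[RHS]/(_ ^+ _) -prodr_const.
  apply: eq_big => [chi | chi]; first by rewrite cP.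
  by rewrite -cP => /(super_lambdaE KX_theory S_super)->.
have [_ hS] := super_fourier_indicator KX_theory S_super.
have [_ hS'] := super_fourier_indicator KX_theory S'_super.
(* Each indicator is the expansion of its own transform, and the two expansions have the same
   coefficients. *)
have eq_ind : indicator R S = indicator R S'.
  apply/ffunP => x; rewrite hS hS'; congr (_ * _).
  by apply: eq_bigr => i _; congr (_ * _); apply: eq_lambda.
apply/setP => x; have /ffunP/(_ x)/eqP := eq_ind.
by rewrite !ffunE Num.Theory.eqr_nat; do 2!case: (x \in _).
Qed.
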